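(* Let $\mathcal{X}\subset\mathbb{R}^d$ be nonempty, convex and compact with diameter at most $D$ (i.e. $\|\mathbf{x}-\mathbf{y}\|\le D$ for all $\mathbf{x},\mathbf{y}\in\mathcal{X}$), and let $f:\mathcal{X}\to\mathbb{R}$ be convex and differentiable with $L$-Lipschitz gradient on $\mathcal{X}$, $L>0$, i.e. $\|\nabla f(\mathbf{x})-\nabla f(\mathbf{y})\|_*\le L\|\mathbf{x}-\mathbf{y}\|$ for all $\mathbf{x},\mathbf{y}\in\mathcal{X}$. Run Frank-Wolfe with heavy ball momentum and restart (described in the context), where $\eta_k^s$ is chosen by one of the following three rules: (i) $\eta_k^s=\delta_k^s$; (ii) $\eta_k^s=\max\Big\{0,\min\Big\{\frac{\langle\nabla f(\mathbf{x}_k^s),\mathbf{x}_k^s-\mathbf{v}_{k+1}^s\rangle}{L\|\mathbf{v}_{k+1}^s-\mathbf{x}_k^s\|^2},1\Big\}\Big\}$; (iii) $\eta_k^s\in\arg\min_{\eta\in[0,1]}f\big((1-\eta)\mathbf{x}_k^s+\eta\mathbf{v}_{k+1}^s\big)$. If there is no restart (the algorithm terminates with $s=0$), then $$\mathcal{G}_k^0=f(\mathbf{x}_k^0)-\Phi_k^0(\mathbf{v}_k^0)\le\frac{2LD^2}{k+1},\qquad\forall k\ge 1. \quad (\ast)$$ If restart happens, then in addition to $(\ast)$, $$\mathcal{G}_k^s=f(\mathbf{x}_k^s)-\Phi_k^s(\mathbf{v}_k^s)<\frac{2LD^2}{k+C^s},\qquad\forall k\ge 1,\ \forall s\ge 1,\qquad\text{with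 } C^s\ge 1+\sum_{j=0}^{s-1}K_j.$$ (Here the indices $(s,k)$ range over those reached by the algorithm.)
   Context: $\|\cdot\|$ is a norm on $\mathbb{R}^d$, $\|\cdot\|_*$ its dual norm, $\langle\cdot,\cdot\rangle$ the inner product. Frank-Wolfe with heavy ball momentum and restart. Stages are indexed by $s=0,1,2,\dots$, iterations inside a stage by $k$. Initialize with any $\mathbf{x}_0^0\in\mathcal{X}$ and $C^0=0$. In stage $s$ set $\mathbf{g}_0^s=\nabla f(\mathbf{x}_0^s)$ and $$\Phi_0^s(\mathbf{x})=f(\mathbf{x}_0^s)+\langle\nabla f(\mathbf{x}_0^s),\mathbf{x}-\mathbf{x}_0^s\rangle,$$ let $\mathbf{v}_0^s\in\arg\min_{\mathbf{x}\in\mathcal{X}}\Phi_0^s(\mathbf{x})$, and for $k=0,1,2,\dots$ do: - $\delta_k^s=\frac{2}{k+2+C^s}$; - $\mathbf{g}_{k+1}^s=(1-\delta_k^s)\mathbf{g}_k^s+\delta_k^s\nabla f(\mathbf{x}_k^s)$; - $\mathbf{v}_{k+1}^s\in\arg\min_{\mathbf{x}\in\mathcal{X}}\langle\mathbf{g}_{k+1}^s,\mathbf{x}\rangle$; - $\mathbf{x}_{k+1}^s=(1-\eta_k^s)\mathbf{x}_k^s+\eta_k^s\mathbf{v}_{k+1}^s$ (in rule (ii), if $\mathbf{v}_{k+1}^s=\mathbf{x}_k^s$ then $\eta_k^s$ is any number in $[0,1]$); - $\bar{\mathbf{v}}_{k+1}^s\in\arg\min_{\mathbf{x}\in\mathcal{X}}\langle\nabla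 f(\mathbf{x}_{k+1}^s),\mathbf{x}\rangle$; - $\Phi_{k+1}^s(\mathbf{x})=(1-\delta_k^s)\Phi_k^s(\mathbf{x})+\delta_k^s\big[f(\mathbf{x}_k^s)+\langle\nabla f(\mathbf{x}_k^s),\mathbf{x}-\mathbf{x}_k^s\rangle\big]$; - generalized FW gap: $\mathcal{G}_{k+1}^s=f(\mathbf{x}_{k+1}^s)-\Phi_{k+1}^s(\mathbf{v}_{k+1}^s)$; - standard FW gap: $\bar{\mathcal{G}}_{k+1}^s=\langle\nabla f(\mathbf{x}_{k+1}^s),\mathbf{x}_{k+1}^s-\bar{\mathbf{v}}_{k+1}^s\rangle$. A restart occurs in stage $s$ at the first index $k\ge 1$ with $\mathcal{G}_k^s>\bar{\mathcal{G}}_k^s$ (while $\mathcal{G}_k^s\le\bar{\mathcal{G}}_k^s$ the stage continues). On restart, set $K_s=k$, $\mathbf{x}_0^{s+1}=\mathbf{x}_{K_s}^s$, $C^{s+1}=\frac{2LD^2}{\mathcal{G}_{K_s}^s}$, and go to stage $s+1$. The algorithm may be terminated at any time (e.g. when $\min\{\mathcal{G}_k^s,\bar{\mathcal{G}}_k^s\}\le\epsilon$ for a prescribed $\epsilon>0$). *)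

(* Defs.v *)
From HB Require Import structures.
From mathcomp Require Import all_boot all_order all_algebra.
From mathcomp Require Import all_classical all_reals all_analysis.

Set Implicit Arguments.
Unset Strict Implicit.
Unset Printing Implicit Defensive.

Import Order.TTheory GRing.Theory Num.Theory.
Import numFieldNormedType.Exports.

Local Open Scope classical_set_scope.
Local Open Scope ring_scope.

Definition dotv (R : realType) (d : nat) (u v : 'rV[R]_d) : R :=
  \sum_(i < d) u 0 i * v 0 i.

(* An arbitrary norm on R^d; the canonical norm `|x| that the library puts on
   'rV[R]_d is the sup norm, and is used below only through its topology. *)
Record is_norm (R : realType) (d : nat) (N : 'rV[R]_d -> R) : Prop := IsNorm {
  is_normD : forall x y, N (x + y) <= N x + N y ;
  is_normZ : forall a x, N (a *: x) = `|a| * N x ;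
  is_norm0_eq0 : forall x, N x = 0 -> x = 0
}.

Definition dual_norm (R : realType) (d : nat) (N : 'rV[R]_d -> R)
    (g : 'rV[R]_d) : R :=
  sup [set dotv g y | y in [set y | N y <= 1]].

(* The function f matters only on X, so differentiability at a point of X is
   relative to X; at interior points of X it is the usual one. When X has empty
   interior a gradient need not be unique, and gradf is any choice of one.
   The norm implicit in o(y - x) is immaterial in finite dimension. *)
Definition is_gradient_on (R : realType) (d : nat) (X : set 'rV[R]_d)
    (f : 'rV[R]_d -> R) (gradf : 'rV[R]_d -> 'rV[R]_d) : Prop :=
  forall x, X x ->
    let F := within X (nbhs x) in
    (fun y : 'rV[R]_d => f y - f x - dotv (gradf x) (y - x))
      =o_F (fun y : 'rV[R]_d => y - x).

Definition is_argmin (R : realType) (T : Type) (A : set T) (phi : T -> R)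
    (a : T) : Prop :=
  A a /\ forall b, A b -> phi a <= phi b.

Definition linearization (R : realType) (d : nat) (f : 'rV[R]_d -> R)
    (gradf : 'rV[R]_d -> 'rV[R]_d) (z y : 'rV[R]_d) : R :=
  f z + dotv (gradf z) (y - z).

Inductive step_rule := FixedStep | SmoothStep | LineSearch.

(* [step_ok N f gradf L rule delta x v eta]: eta is an admissible step size from
   x towards v. In [SmoothStep] the quotient is 0 / 0 when v = x, and eta is
   then only required to lie in [0, 1]. *)
Definition step_ok (R : realType) (d : nat) (N : 'rV[R]_d -> R)
    (f : 'rV[R]_d -> R) (gradf : 'rV[R]_d -> 'rV[R]_d) (L : R)
    (rule : step_rule) (delta : R) (x v : 'rV[R]_d) (eta : R) : Prop :=
  match rule with
  | FixedStep => eta = delta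
  | SmoothStep =>
      (v = x -> 0 <= eta <= 1) /\
      (v <> x ->
         eta = Num.max 0
           (Num.min (dotv (gradf x) (x - v) / (L * N (v - x) ^+ 2)) 1))
  | LineSearch =>
      is_argmin `[0, 1] (fun t : R => f ((1 - t) *: x + t *: v)) eta
  end.

(* The data produced by an execution, indexed by the stage s and the iteration
   k inside the stage. [reached s k] says that the execution got as far as
   iteration k of stage s, and the other values are meaningful only at such
   indices. An execution may be stopped anywhere or go on forever, so [reached]
   is not determined by the other fields. [hb_K s] is the index at which stage
   s restarts, if it does. *)
Record hb_trace (R : realType) (d : nat) := HBTrace {
  hb_x : nat -> nat -> 'rV[R]_d ;
  hb_v : nat -> nat -> 'rV[R]_d ;
  hb_vbar : nat -> nat -> 'rV[R]_d ;
  hb_eta : nat -> nat -> R ;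
  hb_C : nat -> R ;
  hb_K : nat -> nat ;
  reached : nat -> nat -> Prop
}.

Definition hb_delta (R : realType) (d : nat) (T : hb_trace R d) (s k : nat) : R :=
  2 / (k%:R + 2 + hb_C T s).

Fixpoint hb_g (R : realType) (d : nat) (gradf : 'rV[R]_d -> 'rV[R]_d)
    (T : hb_trace R d) (s k : nat) : 'rV[R]_d :=
  match k with
  | 0%N => gradf (hb_x T s 0)
  | j.+1 => (1 - hb_delta T s j) *: hb_g gradf T s j
            + hb_delta T s j *: gradf (hb_x T s j)
  end.

Fixpoint hb_Phi (R : realType) (d : nat) (f : 'rV[R]_d -> R)
    (gradf : 'rV[R]_d -> 'rV[R]_d) (T : hb_trace R d) (s k : nat)
    (y : 'rV[R]_d) : R :=
  match k with
  | 0%N => linearization f gradf (hb_x T s 0) y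
  | j.+1 => (1 - hb_delta T s j) * hb_Phi f gradf T s j y
            + hb_delta T s j * linearization f gradf (hb_x T s j) y
  end.

Definition gen_gap (R : realType) (d : nat) (f : 'rV[R]_d -> R)
    (gradf : 'rV[R]_d -> 'rV[R]_d) (T : hb_trace R d) (s k : nat) : R :=
  f (hb_x T s k) - hb_Phi f gradf T s k (hb_v T s k).

Definition fw_gap (R : realType) (d : nat) (gradf : 'rV[R]_d -> 'rV[R]_d)
    (T : hb_trace R d) (s k : nat) : R :=
  dotv (gradf (hb_x T s k)) (hb_x T s k - hb_vbar T s k).

Definition restart_at (R : realType) (d : nat) (f : 'rV[R]_d -> R)
    (gradf : 'rV[R]_d -> 'rV[R]_d) (T : hb_trace R d) (s k : nat) : Prop :=
  (1 <= k)%N /\ fw_gap gradf T s k < gen_gap f gradf T s k.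

(* In [hb_run_step], [~ restart_at f gradf T s k] makes a stage stop at its
   first restart index; hence the index [hb_K T s] of [hb_run_restart], being
   reached, is the first one. *)
Record hb_run (R : realType) (d : nat) (N : 'rV[R]_d -> R)
    (X : set 'rV[R]_d) (f : 'rV[R]_d -> R) (gradf : 'rV[R]_d -> 'rV[R]_d)
    (L D : R) (rule : step_rule) (T : hb_trace R d) : Prop := HBRun {
  hb_run_init : [/\ reached T 0 0, X (hb_x T 0 0) & hb_C T 0 = 0] ;
  hb_run_stage : forall s, reached T s 0 ->
    is_argmin X (hb_Phi f gradf T s 0) (hb_v T s 0) ;
  hb_run_step : forall s k, reached T s k.+1 ->
    [/\ reached T s k /\ ~ restart_at f gradf T s k,
        is_argmin X (dotv (hb_g gradf T s k.+1)) (hb_v T s k.+1),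
        step_ok N f gradf L rule (hb_delta T s k)
          (hb_x T s k) (hb_v T s k.+1) (hb_eta T s k),
        hb_x T s k.+1 = (1 - hb_eta T s k) *: hb_x T s k
                        + hb_eta T s k *: hb_v T s k.+1 &
        is_argmin X (dotv (gradf (hb_x T s k.+1))) (hb_vbar T s k.+1)] ;
  hb_run_restart : forall s, reached T s.+1 0 ->
    [/\ reached T s (hb_K T s), restart_at f gradf T s (hb_K T s),
        hb_x T s.+1 0 = hb_x T s (hb_K T s) &
        hb_C T s.+1 = 2 * L * D ^+ 2 / gen_gap f gradf T s (hb_K T s)]
}.

(* Main.v *)
(** The gradient is Lipschitz, so each step towards [v] decreases [f] at least
    as much as the quadratic upper model does with step [delta], whichever rule
    chooses the actual step: rule (ii) minimizes that model over [0, 1], and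
    rule (iii) minimizes [f] itself. Since [v_k] minimizes [Phi_k], this gives
    [G_(k+1) <= (1 - delta_k) G_k + L delta_k^2 D^2 / 2], whence both rates by
    induction on [k]. At a restart the initial gap of the new stage is the
    standard gap at the restart point, which is smaller than the generalized
    one, and the latter equals [2 L D^2 / C] by the choice of the new [C]; so
    the induction starts from a strict inequality, and the rate of the finished
    stage bounds the new [C] from below. *)

Require Import Defs.
From HB Require Import structures.
From mathcomp Require Import all_boot all_order all_algebra.
From mathcomp Require Import all_classical all_reals all_analysis.
From mathcomp Require Import ring lra.

Import Order.TTheory GRing.Theory Num.Theory.
Import numFieldNormedType.Exports.

Local Open Scope classical_set_scope.
Local Open Scope ring_scope.

Set Implicit Arguments.
Unset Strict Implicit.
Unset Printing Implicit Defensive.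

(** * The inner product and the sup norm *)

Section DotProduct.
Context {R : realType} {d : nat}.
Implicit Types (a : R) (g u v : 'rV[R]_d).

Lemma dotvDl g u v : dotv (g + u) v = dotv g v + dotv u v.
Proof. by rewrite -big_split; apply: eq_bigr => i _; rewrite mxE mulrDl. Qed.

Lemma dotvDr g u v : dotv g (u + v) = dotv g u + dotv g v.
Proof. by rewrite -big_split; apply: eq_bigr => i _; rewrite mxE mulrDr. Qed.

Lemma dotvZl a u v : dotv (a *: u) v = a * dotv u v.
Proof. by rewrite mulr_sumr; apply: eq_bigr => i _; rewrite mxE mulrA. Qed.

Lemma dotvZr a u v : dotv u (a *: v) = a * dotv u v.
Proof. by rewrite mulr_sumr; apply: eq_bigr => i _; rewrite mxE mulrCA. Qed.

Lemma dotvBl g u v : dotv (g - u) v = dotv g v - dotv u v.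
Proof. by rewrite dotvDl -scaleN1r dotvZl mulN1r. Qed.

Lemma dotvBr g u v : dotv g (u - v) = dotv g u - dotv g v.
Proof. by rewrite dotvDr -scaleN1r dotvZr mulN1r. Qed.

Lemma dotv0r g : dotv g 0 = 0.
Proof. by rewrite -(scale0r 0) dotvZr mul0r. Qed.

Lemma coord_le_norm u (i : 'I_d) : `|u 0 i| <= `|u|.
Proof.
rewrite [leRHS]mx_normrE.
exact: (le_bigmax _ (fun ij : 'I_1 * 'I_d => `|u ij.1 ij.2|) (0, i)).
Qed.

Lemma dotv_le_norm g u : dotv g u <= (\sum_i `|g 0 i|) * `|u|.
Proof.
rewrite mulr_suml; apply: ler_sum => i _.
rewrite (le_trans (ler_norm _))// normrM ler_wpM2l//.
exact: coord_le_norm.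
Qed.

End DotProduct.

(** * Equivalence of norms on R^d and the duality inequality *)

Section Norms.
Context {R : realType} {d : nat} {N : 'rV[R]_d -> R}.
Hypothesis hN : is_norm N.
Implicit Types (a : R) (g u v : 'rV[R]_d).

Lemma is_norm0 : N 0 = 0.
Proof. by rewrite -(scale0r 0) (is_normZ hN) normr0 mul0r. Qed.

Lemma is_normN u : N (- u) = N u.
Proof. by rewrite -scaleN1r (is_normZ hN) normrN1 mul1r. Qed.

Lemma is_norm_ge0 u : 0 <= N u.
Proof.
have := is_normD hN u (- u); rewrite subrr is_norm0 is_normN.
by rewrite -mulr2n pmulrn_lge0.
Qed.

Lemma is_norm_gt0 u : u != 0 -> 0 < N u.
Proof.
move=> u0; rewrite lt_neqAle is_norm_ge0 andbT eq_sym.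
by apply: contra u0 => /eqP/(is_norm0_eq0 hN)->.
Qed.

Lemma is_norm_le_mx_norm u : N u <= (\sum_i N 'e_i) * `|u|.
Proof.
rewrite {1}(row_sum_delta u) mulr_suml.
apply: (@le_trans _ _ (\sum_i N (u 0 i *: 'e_i))).
  apply: (big_ind2 (fun x y => N x <= y)).
  - by rewrite is_norm0.
  - by move=> x a y b xa yb; rewrite (le_trans (is_normD hN _ _))// lerD.
  - by [].
apply: ler_sum => i _; rewrite (is_normZ hN) mulrC.
by rewrite ler_wpM2l ?is_norm_ge0// coord_le_norm.
Qed.

Lemma is_norm_continuous : continuous N.
Proof.
move=> x; apply: (proj2 (cvgrPdist_le (F := nbhs x) N (N x))) => e e0.
set M := \sum_i N 'e_i.
have M0 : 0 <= M by apply: sumr_ge0 => i _; exact: is_norm_ge0.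
have M1 : 0 < M + 1 by rewrite ltr_pwDr.
have lip y z : N y - N z <= M * `|y - z|.
  rewrite lerBlDr (le_trans _ (lerD (is_norm_le_mx_norm _) (lexx _)))//.
  by rewrite -{1}(subrK z y) (is_normD hN).
near=> y.
have xy : M * `|x - y| <= e.
  (* The denominator is [M + 1] because [M] vanishes when [d = 0]. *)
  have : `|x - y| <= e / (M + 1).
    near: y; apply: (proj1 (cvgrPdist_le (F := nbhs x) id x)).
      exact: cvg_id.
    by rewrite divr_gt0.
  rewrite ler_pdivlMr// mulrC; apply: le_trans.
  by rewrite ler_wpM2r// lerDl.
rewrite ler_norml lerNl opprB; apply/andP; split.
  by rewrite (le_trans (lip _ _))// distrC.
exact: le_trans (lip _ _) xy.
Unshelve. all: by end_near. Qed.

(** On the compact unit sphere of the sup norm, [N] attains a minimum; it is positive and serves as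
    [c], by homogeneity. *)
Lemma mx_norm_le_is_norm : exists2 c, 0 < c & forall u, c * `|u| <= N u.
Proof.
pose S := [set u : 'rV[R]_d | `|u| = 1].
(* The sphere is empty only when [d = 0]; then every vector is 0. *)
have [S0|/set0P S0] := eqVneq S set0.
  exists 1 => // u; have [->|u0] := eqVneq u 0.
    by rewrite normr0 mulr0 is_norm0.
  suff : S (`|u|^-1 *: u) by rewrite S0.
  by rewrite /S/= normrZ normfV normr_id mulVf// normr_eq0.
have Scompact : compact S.
  apply: bounded_closed_compact.
    exists 1; split; first exact: real1.
    by move=> r r1 u /= ->; rewrite ltW.
  apply: (@preimage_closed _ _ (fun u : 'rV[R]_d => `|u|) [set 1]).
    by move=> u _; exact: norm_continuous.
  exact: closed_eq.
have [e eS eN] := EVT_min_rV S0 Scompact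
  (continuous_subspaceT is_norm_continuous).
move: eS; rewrite inE /S/= => e1.
have e0 : e != 0 by rewrite -normr_eq0 e1 oner_neq0.
exists (N e) => [|u]; first exact: is_norm_gt0.
have [->|u0] := eqVneq u 0; first by rewrite normr0 mulr0 is_norm0.
have nu : 0 < `|u| by rewrite normr_gt0.
have : N e <= N (`|u|^-1 *: u).
  by apply: eN; rewrite inE /S/= normrZ normfV normr_id mulVf// gt_eqF.
by rewrite (is_normZ hN) normfV normr_id ler_pdivlMl// mulrC.
Qed.

(** [sup] is an upper bound only of a set bounded above; the comparison with the sup norm ensures
    this on the unit ball of [N]. *)
Lemma dotv_le_dual_norm g u : dotv g u <= dual_norm N g * N u.
Proof.
have [c c0 cN] := mx_norm_le_is_norm.
have ub : has_ubound [set dotv g y | y in [set y | N y <= 1]].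
  exists ((\sum_i `|g 0 i|) * c^-1) => _ [y /= Ny <-].
  rewrite (le_trans (dotv_le_norm _ _))// ler_wpM2l ?sumr_ge0//.
  by rewrite -[c^-1]mulr1 ler_pdivlMl// (le_trans (cN y)).
have [->|u0] := eqVneq u 0; first by rewrite dotv0r is_norm0 mulr0.
have Nu := is_norm_gt0 u0.
rewrite -ler_pdivrMr// mulrC -dotvZr; apply: ub_le_sup => //.
exists ((N u)^-1 *: u) => //=.
by rewrite (is_normZ hN) normfV ger0_norm ?is_norm_ge0// mulVf// gt_eqF.
Qed.

End Norms.

Lemma convex_set_comb (R : realType) (d : nat) (X : set 'rV[R]_d)
    (x y : 'rV[R]_d) (t : R) :
  convex_set X -> X x -> X y -> 0 <= t <= 1 -> X ((1 - t) *: x + t *: y).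
Proof.
move=> cX Xx Xy /andP[t0 t1].
have := cX y x (Itv01 t0 t1); rewrite !inE => /(_ Xy Xx).
by rewrite addrC.
Qed.

(** * The quadratic upper model of a function with Lipschitz gradient *)

Section Descent.
Context {R : realType} {d : nat} {N : 'rV[R]_d -> R} {X : set 'rV[R]_d}.
Context {f : 'rV[R]_d -> R} {gradf : 'rV[R]_d -> 'rV[R]_d} {L : R}.
Hypotheses (hN : is_norm N) (hX : convex_set X).
Hypothesis hgrad : is_gradient_on X f gradf.
Hypothesis hLip : forall x y, X x -> X y ->
  dual_norm N (gradf x - gradf y) <= L * N (x - y).

Section Segment.
Context {x y : 'rV[R]_d}.
Hypotheses (Xx : X x) (Xy : X y).

Let z (t : R) : 'rV[R]_d := (1 - t) *: x + t *: y.

Lemma segment_subr (s t : R) : z s - z t = (s - t) *: (y - x).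
Proof. by apply/rowP => i; rewrite !mxE; ring. Qed.

(** Transfers the expansion relative to [X] to the parameter of the segment, endpoints included;
    hence the restriction to [s] in [0, 1]. *)
Lemma segment_first_order (t e : R) : 0 <= t <= 1 -> 0 < e ->
  \forall s \near t, 0 <= s <= 1 ->
    `|f (z s) - f (z t) - (s - t) * dotv (gradf (z t)) (y - x)|
      <= e * `|s - t|.
Proof.
move=> t01 e0; set M := `|y - x| + 1.
have M0 : 0 < M by rewrite ltr_pwDr.
have eM0 : 0 < e / M by rewrite divr_gt0.
have Xz s : 0 <= s <= 1 -> X (z s) by exact: convex_set_comb.
have zt : z s @[s --> t] --> z t.
  apply: (cvgD (F := nbhs t)); apply: (cvgZ (F := nbhs t)).
  - by apply: (cvgB (F := nbhs t)); [exact: cvg_cst|exact: cvg_id].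
  - exact: cvg_cst.
  - exact: cvg_id.
  - exact: cvg_cst.
have := (proj1 (eqoP _ _ _) (hgrad (Xz _ t01))) _ eM0.
rewrite /= => near_zt.
apply: (filterS (F := nbhs t) _ (zt _ near_zt)) => s /= H s01.
move: (H (Xz _ s01)); rewrite segment_subr dotvZr => /le_trans; apply.
rewrite normrZ mulrCA [leRHS]mulrC ler_wpM2l// mulrAC ler_pdivrMr//.
by rewrite ler_pM2l// lerDl.
Qed.

(** Near an interior parameter the restriction to [0, 1] is automatic, so the derivative is an
    ordinary two-sided one. *)
Lemma segment_is_derive (t : R) : t \in `]0, 1[ ->
  is_derive t 1 (f \o z) (dotv (gradf (z t)) (y - x)).
Proof.
rewrite in_itv/= => /andP[t0 t1].
set a := dotv _ _.
have t01 : 0 <= t <= 1 by rewrite !ltW.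
have H : h^-1 *: ((f \o z \o shift t) (h *: 1) - (f \o z) t) @[h --> 0^'] --> a.
  apply/cvgrPdist_le => e e0.
  have near_t : \forall s \near t,
      `|f (z s) - f (z t) - (s - t) * a| <= e * `|s - t|.
    near=> s.
    have s0 : 0 <= s by near: s; apply: lt_le_nbhsr.
    have s1 : s <= 1 by near: s; apply: lt_le_nbhsl.
    have s01 : 0 <= s <= 1 by rewrite s0.
    by move: s01; near: s; exact: segment_first_order.
  have near_0 : \forall h \near (0 : R),
      `|f (z (h + t)) - f (z t) - h * a| <= e * `|h|.
    have cvg_t : h + t @[h --> (0 : R)] --> t.
      rewrite -[X in _ --> X]add0r.
      by apply: (cvgD (F := nbhs 0)); [exact: cvg_id|exact: cvg_cst].
    apply: (filterS (F := nbhs 0) _ (cvg_t _ near_t)) => h /=.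
    by rewrite addrK.
  near=> h.
  have h0 : h != 0 by near: h; exact: nbhs_dnbhs_neq.
  have : `|f (z (h + t)) - f (z t) - h * a| <= e * `|h|.
    by near: h; exact: nbhs_dnbhs.
  rewrite /= [h *: 1]mulr1 -ler_pdivrMr ?normr_gt0// -normfV -normrM.
  rewrite distrC; congr (`|_| <= _).
  by rewrite [_ *: _]mulrC mulrBl mulrAC mulfV// mul1r.
apply: DeriveDef; first by apply/cvg_ex; exists a.
exact: cvg_lim H.
Unshelve. all: by end_near. Qed.

Lemma segment_continuous : {within `[0, 1], continuous (f \o z)}.
Proof.
apply/subspace_continuousP => t; rewrite /= in_itv/= => t01.
set c := dotv (gradf (z t)) (y - x).
apply/cvgrPdist_le => e e0; rewrite near_withinE.
near=> s => /=; rewrite in_itv/= => s01.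
(* With error constant 1 the expansion bounds the increment of [f \o z] by [(1 + |c|) |s - t|]. *)
have H : `|f (z s) - f (z t) - (s - t) * c| <= `|s - t|.
  rewrite -[leRHS]mul1r; move: s01; near: s.
  exact: segment_first_order.
have M0 : 0 < 1 + `|c| by rewrite ltr_pwDl.
have st : `|s - t| * (1 + `|c|) <= e.
  rewrite -ler_pdivlMr// distrC; near: s.
  apply: (proj1 (cvgrPdist_le (F := nbhs t) id t)); first exact: cvg_id.
  by rewrite divr_gt0.
apply: le_trans st; rewrite distrC mulrDr mulr1 -normrM.
rewrite -(subrK ((s - t) * c) (f (z s) - f (z t))).
by rewrite (le_trans (ler_normD _ _))// lerD2r.
Unshelve. all: by end_near. Qed.

End Segment.

(* The difference of [f] and its quadratic upper model along the segment has
   nonpositive derivative. *)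
Lemma descent (x y : 'rV[R]_d) : X x -> X y ->
  f y <= f x + dotv (gradf x) (y - x) + L / 2 * N (y - x) ^+ 2.
Proof.
move=> Xx Xy; set u := y - x; set a := dotv (gradf x) u.
pose z t : 'rV[R]_d := (1 - t) *: x + t *: y.
pose c := L / 2 * N u ^+ 2.
pose q (t : R) : R := a * t + c * t ^+ 2.
have dq (t : R) : is_derive t (1 : R) q (a + 2 * c * t).
  rewrite /q; apply: is_derive_eq.
  rewrite /GRing.scale/=; ring.
have dpsi (t : R) : t \in `]0, 1[ ->
    is_derive t (1 : R) (f \o z - q) (dotv (gradf (z t)) u - (a + 2 * c * t)).
  by move=> t01; apply: is_deriveB; exact: segment_is_derive.
have cpsi : {within `[0, 1], continuous (f \o z - q)}.
  apply: within_continuousB; first exact: segment_continuous.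
  by apply: derivable_within_continuous => t _; exact: ex_derive.
have [t] := MVT ltr01 dpsi cpsi.
rewrite in_itv/= => /andP[t0 t1].
have -> : (f \o z - q) 1 = f y - (a + c).
  by rewrite /q !fctE /z subrr scale0r add0r scale1r expr1n !mulr1.
have -> : (f \o z - q) 0 = f x.
  rewrite /q !fctE /z subr0 scale0r addr0 scale1r expr0n/=.
  by rewrite !mulr0 addr0 subr0.
have Xz : X (z t) by apply: convex_set_comb => //; rewrite !ltW.
have ztx : z t - x = t *: u.
  by apply/rowP => i; rewrite !mxE; ring.
(* Duality, the Lipschitz gradient and [z t - x = t u] give the bound [L t N(u)^2], which is
   [2 c t]. *)
have : dotv (gradf (z t)) u - a <= 2 * c * t.
  rewrite -dotvBl (le_trans (dotv_le_dual_norm hN _ _))//.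
  rewrite (le_trans (ler_wpM2r (is_norm_ge0 hN _) (hLip Xz Xx)))//.
  rewrite ztx (is_normZ hN) gtr0_norm// /c le_eqVlt; apply/orP; left.
  by apply/eqP; field.
rewrite subr0 mulr1 -/a -/c; lra.
Qed.

End Descent.

(** The parabola has its vertex at [r], and [e] is the point of [0, 1] nearest to [r]. *)
Lemma clip_minimizes (R : realType) (r t : R) : 0 <= t <= 1 ->
  let e := Num.max 0 (Num.min r 1) in
  0 <= e <= 1 /\ e ^+ 2 / 2 - e * r <= t ^+ 2 / 2 - t * r.
Proof.
move=> /andP[t0 t1] /=.
have sq (x : R) : 0 <= (x - t) ^+ 2 by exact: sqr_ge0.
have [r1|/ltW r1] := leP r 1; last first.
  rewrite max_r// lexx ler01; split => //.
  have : 0 <= (1 - t) * (r - 1) by rewrite mulr_ge0 ?subr_ge0.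
  have := sq 1; nra.
have [r0|/ltW r0] := leP 0 r.
  by rewrite r0 r1; split => //; have := sq r; nra.
rewrite lexx ler01; split => //.
have : 0 <= t * - r by rewrite mulr_ge0 ?oppr_ge0.
have := sq 0; nra.
Qed.

(* Both are applied with [M = 2 L D^2]: to [b = k] in the first stage, and to
   [b = k + C] in the later ones. *)
Section Rate.
Context {R : realType}.
Implicit Types b M : R.

Lemma rate_step_first b M : 0 <= b -> 0 <= M ->
  (1 - 2 / (b + 2)) * (M / (b + 1)) + M / 4 * (2 / (b + 2)) ^+ 2 <= M / (b + 2).
Proof.
move=> b0 M0; rewrite -subr_ge0.
have -> : M / (b + 2) - ((1 - 2 / (b + 2)) * (M / (b + 1))
    + M / 4 * (2 / (b + 2)) ^+ 2) = M / ((b + 1) * (b + 2) ^+ 2).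
  by field; rewrite !gt_eqF//; lra.
by rewrite divr_ge0// mulr_ge0 ?sqr_ge0//; lra.
Qed.

Lemma rate_step b M : 0 < b -> 0 <= M ->
  (1 - 2 / (b + 2)) * (M / b) + M / 4 * (2 / (b + 2)) ^+ 2 <= M / (b + 1).
Proof.
move=> b0 M0; rewrite -subr_ge0.
have -> : M / (b + 1) - ((1 - 2 / (b + 2)) * (M / b)
    + M / 4 * (2 / (b + 2)) ^+ 2) = M / ((b + 1) * (b + 2) ^+ 2).
  by field; rewrite !gt_eqF//; lra.
by rewrite divr_ge0// mulr_ge0 ?sqr_ge0//; lra.
Qed.

End Rate.

(** The slope of the affine model obeys the recursion of [hb_g]; hence minimizing [<g_k, .>] amounts
    to minimizing [Phi_k]. *)
Lemma hb_PhiE (R : realType) (d : nat) (f : 'rV[R]_d -> R)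
    (gradf : 'rV[R]_d -> 'rV[R]_d) (T : hb_trace R d) (s k : nat) y :
  hb_Phi f gradf T s k y = hb_Phi f gradf T s k 0 + dotv (hb_g gradf T s k) y.
Proof.
elim: k => [|k IH] /=; first by rewrite /linearization !dotvBr dotv0r; ring.
rewrite IH /linearization !dotvBr dotv0r dotvDl !dotvZl; ring.
Qed.

(** * Decrease of the gap along an execution *)

Section Run.
Context {R : realType} {d : nat} {N : 'rV[R]_d -> R} {X : set 'rV[R]_d}.
Context {f : 'rV[R]_d -> R} {gradf : 'rV[R]_d -> 'rV[R]_d} {L D : R}.
Context {rule : step_rule} {T : hb_trace R d}.
Hypotheses (hN : is_norm N) (hX : convex_set X).
Hypothesis hD : forall x y, X x -> X y -> N (x - y) <= D.
Hypothesis hgrad : is_gradient_on X f gradf.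
Hypothesis hL : 0 < L.
Hypothesis hLip : forall x y, X x -> X y ->
  dual_norm N (gradf x - gradf y) <= L * N (x - y).
Hypothesis hrun : hb_run N X f gradf L D rule T.

Local Notation M := (2 * L * D ^+ 2).
Local Notation G := (gen_gap f gradf T).

(** The bound involves [t], not the step [e] actually taken, so that the three rules need no
    distinction afterwards. *)
Lemma step_decrease (t e : R) (x v : 'rV[R]_d) : X x -> X v -> 0 <= t <= 1 ->
  step_ok N f gradf L rule t x v e ->
  0 <= e <= 1 /\ f ((1 - e) *: x + e *: v) <=
    f x + t * dotv (gradf x) (v - x) + L / 2 * t ^+ 2 * N (v - x) ^+ 2.
Proof.
move=> Xx Xv t01.
have bound r : 0 <= r <= 1 -> f ((1 - r) *: x + r *: v) <=
    f x + r * dotv (gradf x) (v - x) + L / 2 * r ^+ 2 * N (v - x) ^+ 2.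
  move=> r01.
  have := descent hN hX hgrad hLip Xx (convex_set_comb hX Xx Xv r01).
  have -> : (1 - r) *: x + r *: v - x = r *: (v - x).
    by apply/rowP => i; rewrite !mxE; ring.
  by rewrite dotvZr (is_normZ hN) exprMn real_normK ?num_real// mulrA.
case: rule => /=.
- by move=> ->; split => //; exact: bound.
- move=> [vx vNx]; have [vxE|vxN] := pselect (v = x).
    split; first exact: vx.
    rewrite vxE -scalerDl subrK scale1r subrr dotv0r (is_norm0 hN) expr0n/=.
    by rewrite !mulr0 !addr0.
  rewrite (vNx vxN); set n := N (v - x); set r := _ / _.
  have n0 : 0 < n by apply: (is_norm_gt0 hN); rewrite subr_eq0; exact/eqP.
  have [e01 er] := clip_minimizes r t01.
  split => //; apply: (le_trans (bound _ e01)).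
  (* With this the model at step [e] is [f x + L n^2 (e^2 / 2 - e r)], the parabola minimized by
     clipping. *)
  have -> : dotv (gradf x) (v - x) = - (r * (L * n ^+ 2)).
    rewrite divfK ?gt_eqF ?mulr_gt0 ?exprn_gt0//.
    by rewrite !dotvBr opprB.
  rewrite -/n -!addrA lerD2l; set m := Num.max _ _ in er *.
  have Ln : 0 <= L * n ^+ 2 by rewrite mulr_ge0 ?sqr_ge0 ?ltW.
  have := ler_wpM2l Ln er; nra.
- move=> [e01 emin]; split; first by move: e01; rewrite /= in_itv.
  apply: (le_trans (emin t _)); last exact: bound.
  by rewrite /= in_itv.
Qed.

Lemma reached_stage (s k : nat) : reached T s k -> reached T s 0.
Proof. by elim: k => // k IH /(hb_run_step hrun)[[/IH]]. Qed.

Lemma hb_v_argmin (s k : nat) : reached T s k ->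
  is_argmin X (hb_Phi f gradf T s k) (hb_v T s k).
Proof.
case: k => [|k]; first exact: hb_run_stage hrun s.
move=> /(hb_run_step hrun)[_ [Xv vmin] _ _ _]; split => // y Xy.
by rewrite hb_PhiE [leRHS]hb_PhiE lerD2l vmin.
Qed.

(** * Rates within a single stage *)

Section Stage.
Context {s : nat}.
Hypotheses (Xs : X (hb_x T s 0)) (C0 : 0 <= hb_C T s).

Lemma hb_delta_itv (k : nat) : 0 <= hb_delta T s k <= 1.
Proof.
have k0 : 0 <= k%:R :> R by exact: ler0n.
have den0 : 0 < k%:R + 2 + hb_C T s by rewrite ltr_wpDr// ltr_wpDl.
rewrite /hb_delta divr_ge0 ?(ltW den0)//= ler_pdivrMr// mul1r.
by move: C0 k0; lra.
Qed.

Lemma hb_x_in (k : nat) : reached T s k -> X (hb_x T s k).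
Proof.
elim: k => // k IH /(hb_run_step hrun)[[/IH Xk _] [Xv _] st -> _].
apply: convex_set_comb => //.
by have [] := step_decrease Xk Xv (hb_delta_itv k) st.
Qed.

(** In [Phi_(k+1)(v_(k+1))] the old model is at least [Phi_k(v_k)], and the new linearization
    cancels the first-order term of the decrease bound. The quadratic term is at most
    [L delta^2 D^2 / 2 = M delta^2 / 4]. *)
Lemma gen_gap_step (k : nat) : reached T s k.+1 ->
  G s k.+1 <= (1 - hb_delta T s k) * G s k + M / 4 * hb_delta T s k ^+ 2.
Proof.
move=> rk; have [[rk' _] [Xv _] st xE _] := hb_run_step hrun rk.
have Xk := hb_x_in rk'.
have [_] := step_decrease Xk Xv (hb_delta_itv k) st.
rewrite -xE /gen_gap /= /linearization.
have [_ /(_ _ Xv) vmin] := hb_v_argmin rk'.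
have /andP[dk0 dk1] := hb_delta_itv k.
move: (hb_delta T s k) dk0 dk1 => t t0 t1.
have ND : L / 2 * t ^+ 2 * N (hb_v T s k.+1 - hb_x T s k) ^+ 2 <=
    M / 4 * t ^+ 2.
  have -> : M / 4 * t ^+ 2 = L / 2 * t ^+ 2 * D ^+ 2 by field.
  rewrite ler_wpM2l ?mulr_ge0 ?sqr_ge0 ?divr_ge0 ?(ltW hL)//.
  rewrite ler_sqr ?nnegrE ?(is_norm_ge0 hN) ?hD//.
  by rewrite (le_trans (is_norm_ge0 hN _) (hD Xv Xk)).
have t1' : 0 <= 1 - t by lra.
have := ler_wpM2l t1' vmin; lra.
Qed.

Lemma rate_const_ge0 : 0 <= M.
Proof. by rewrite mulr_ge0 ?sqr_ge0// mulr_ge0// ltW. Qed.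

Lemma gen_gap_le (k : nat) : hb_C T s = 0 -> (1 <= k)%N -> reached T s k ->
  G s k <= M / (k%:R + 1).
Proof.
case: k => // k Cs _; elim: k => [|k IH] rk.
  (* With [C = 0] the weight [delta_0] is 1, so the initial gap drops out and
     [G_1 <= M / 4 <= M / 2]. *)
  have := gen_gap_step rk; rewrite /hb_delta Cs addr0 add0r divff ?subrr//.
  rewrite mul0r add0r expr1n mulr1 => /le_trans; apply.
  rewrite (_ : 1 + 1 = 2)//; have := rate_const_ge0; lra.
have [[rk' _] _ _ _ _] := hb_run_step hrun rk.
apply: (le_trans (gen_gap_step rk)).
have /andP[_ dk1] := hb_delta_itv k.+1.
have dk1' : 0 <= 1 - hb_delta T s k.+1 by rewrite subr_ge0.
rewrite (le_trans (lerD (ler_wpM2l dk1' (IH rk')) (lexx _)))//.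
rewrite /hb_delta Cs addr0.
apply: (le_trans (rate_step_first (ler0n _ _) rate_const_ge0)).
by rewrite -(natr1 k.+1) -addrA.
Qed.

(** Strictness survives each step since [1 - delta_k > 0], which at [k = 0] relies on [C > 0]. *)
Lemma gen_gap_lt (k : nat) : 0 < hb_C T s -> G s 0 < M / hb_C T s ->
  reached T s k -> G s k < M / (k%:R + hb_C T s).
Proof.
move=> Cs G0; elim: k => [|k IH] rk; first by rewrite add0r.
have [[rk' _] _ _ _ _] := hb_run_step hrun rk.
apply: (le_lt_trans (gen_gap_step rk)).
have b0 : 0 < k%:R + hb_C T s by rewrite ltr_wpDl.
rewrite /hb_delta -(natr1 k) ![_ + _ + hb_C T s]addrAC.
apply: lt_le_trans (rate_step b0 rate_const_ge0).
rewrite ltrD2r ltr_pM2l ?IH// subr_gt0 ltr_pdivrMr ?mul1r ?ltrDr//.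
exact: addr_gt0.
Qed.

End Stage.

(** Used with [c = 1] for stage 0 and [c = C^s] for later ones: the assumed bound is the rate of the
    stage at its restart index. *)
Lemma restart_stage (s : nat) (c : R) :
  X (hb_x T s 0) -> 0 <= hb_C T s -> 0 < c -> reached T s.+1 0 ->
  ((1 <= hb_K T s)%N -> reached T s (hb_K T s) ->
    G s (hb_K T s) <= M / ((hb_K T s)%:R + c)) ->
  [/\ X (hb_x T s.+1 0), (hb_K T s)%:R + c <= hb_C T s.+1 &
      G s.+1 0 < M / hb_C T s.+1].
Proof.
move=> Xs C0 c0 rs gapK; have [rK [K1 restart] xE CE] := hb_run_restart hrun rs.
have XK := hb_x_in Xs C0 rK.
have [_ vbar_min] : is_argmin X (dotv (gradf (hb_x T s (hb_K T s))))
    (hb_vbar T s (hb_K T s)).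
  by case: (hb_K T s) K1 rK => // k _ /(hb_run_step hrun)[].
(* This makes the generalized gap at the restart positive, so that its rate can be inverted. *)
have fw_ge0 : 0 <= fw_gap gradf T s (hb_K T s).
  by rewrite /fw_gap dotvBr subr_ge0 vbar_min.
have GK0 := le_lt_trans fw_ge0 restart.
have := gapK K1 rK; have Kc : 0 < (hb_K T s)%:R + c by rewrite ltr_wpDl.
rewrite ler_pdivlMr// mulrC -ler_pdivlMr// => GK.
have MG : 0 < M / G s (hb_K T s) by exact: lt_le_trans Kc GK.
split; [by rewrite xE | by rewrite CE |].
(* [M / (M / G) = G] requires [M] nonzero, which follows from [M / G > 0]. *)
rewrite CE invf_div mulrC divfK; last first.
  by apply/eqP => M0; move: MG; rewrite M0 mul0r ltxx.
apply: le_lt_trans restart.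
(* The initial model is the linearization at the restart point, so the initial gap is
   [<grad f(x), x - v_0>], and [vbar] maximizes such products. *)
have [Xv _] := hb_v_argmin rs.
rewrite /gen_gap /fw_gap /= /linearization xE.
have := vbar_min _ Xv; rewrite !dotvBr; lra.
Qed.

(** Accumulates [C^(s+1) >= K_s + C^s] from [C^1 >= K_0 + 1], where the 1 comes from the rate
    [M / (k + 1)] of stage 0. The sum also yields the positivity of [C] that the next stage
    needs. *)
Lemma stage_invariant (s : nat) : reached T s.+1 0 ->
  [/\ X (hb_x T s.+1 0), 1 + \sum_(0 <= j < s.+1) (hb_K T j)%:R <= hb_C T s.+1 &
      G s.+1 0 < M / hb_C T s.+1].
Proof.
elim: s => [|s IH] rs; have [rK _ _ _] := hb_run_restart hrun rs.
  have [_ X0 C0] := hb_run_init hrun.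
  have C0' : 0 <= hb_C T 0 by rewrite C0.
  have [|X1 KC G1] := restart_stage X0 C0' ltr01 rs; first exact: gen_gap_le.
  by split => //; rewrite big_nat1 addrC.
have [Xs sumC Gs] := IH (reached_stage rK).
have sum0 : 0 <= \sum_(0 <= j < s.+1) (hb_K T j)%:R :> R by exact: sumr_ge0.
have C0 : 0 < hb_C T s.+1 by lra.
have [|X1 KC G1] := restart_stage Xs (ltW C0) C0 rs.
  by move=> _ /(gen_gap_lt Xs (ltW C0) C0 Gs)/ltW.
by split => //; rewrite big_nat_recr//=; lra.
Qed.

End Run.

Theorem theorem4 (R : realType) (d : nat) (N : 'rV[R]_d -> R)
    (X : set 'rV[R]_d) (f : 'rV[R]_d -> R) (gradf : 'rV[R]_d -> 'rV[R]_d)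
    (L D : R) (rule : step_rule) (T : hb_trace R d)
    (hN : is_norm N)
    (hX0 : X !=set0)
    (hXconv : convex_set X)
    (hXcomp : compact X)
    (hD : forall x y, X x -> X y -> N (x - y) <= D)
    (hfconv : convex_function X f)
    (hgrad : is_gradient_on X f gradf)
    (hL : 0 < L)
    (hLip : forall x y, X x -> X y ->
       dual_norm N (gradf x - gradf y) <= L * N (x - y))
    (hrun : hb_run N X f gradf L D rule T) :
  (forall k, (1 <= k)%N -> reached T 0 k ->
     gen_gap f gradf T 0 k <= 2 * L * D ^+ 2 / (k%:R + 1)) /\
  (forall s, (1 <= s)%N ->
     (reached T s 0 -> 1 + \sum_(0 <= j < s) (hb_K T j)%:R <= hb_C T s) /\
     (forall k, (1 <= k)%N -> reached T s k ->
        gen_gap f gradf T s k < 2 * L * D ^+ 2 / (k%:R + hb_C T s))).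
Proof.
split=> [k k1 rk|[//|s] _].
  have [_ X0 C0] := hb_run_init hrun.
  by apply: (gen_gap_le hN hXconv hD hgrad hL hLip hrun); rewrite ?C0.
split=> [rs|k k1 rk].
  by have [] := stage_invariant hN hXconv hD hgrad hL hLip hrun rs.
have [Xs sumC Gs] := stage_invariant hN hXconv hD hgrad hL hLip hrun
  (reached_stage hrun rk).
have sum0 : 0 <= \sum_(0 <= j < s.+1) (hb_K T j)%:R :> R by exact: sumr_ge0.
have C0 : 0 < hb_C T s.+1 by lra.
exact: (gen_gap_lt hN hXconv hD hgrad hL hLip hrun Xs (ltW C0)).
Qed.
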